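(* Let $L$ be a first-order language, let $\mathbb A,\mathbb B$ be $L$-structures and let $F:\mathbb A\to\mathbb B$ be an isomorphism. Then $(\mathbb A,\mathbb B)\models a\approx F(a)$ for all $a\in\mathbb A$.
   Context: Universes of different $L$-structures are arbitrary sets and may share elements. An $L$-formula is called conjunctive if it contains no disjunctions and negation occurs only directly in front of atomic formulas. For an $L$-structure $\mathbb A$ and $a\in\mathbb A$, the conjunctive type of $a$ is $c\text-Type_\mathbb A(a):=\{\varphi(y)\mid \varphi \text{ a conjunctive } L\text{-formula with one free variable } y,\ \mathbb A\models\varphi(a)\}$. For $L$-structures $\mathbb A,\mathbb B$ and $a\in\mathbb A$, $b\in\mathbb B$, put $T(a,b):=c\text-Type_\mathbb A(a)\cap c\text-Type_\mathbb B(b)$. Define $(\mathbb A,\mathbb B)\models a\lesssim b$ iff $T(a,b)$ is $\subseteq$-maximal with respect to $b$ except for $a$ in case $a\in\mathbb B$, i.e. there is no $b'\in\mathbb B$ with $b'\neq a$ such that $T(a,b)\subsetneq T(a,b')$. Define $(\mathbb A,\mathbb B)\models a\approx b$ iff $(\mathbb A,\mathbb B)\models a\lesssim b$ and $(\mathbb B,\mathbb A)\models b\lesssim a$. *)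

(* Defs.v *)
From mathcomp Require Import all_boot.
From mathcomp Require Import boolp classical_sets.

Set Implicit Arguments.
Unset Strict Implicit.
Unset Printing Implicit Defensive.

Local Open Scope classical_set_scope.

(* Constants are function symbols of arity 0. *)
Record language := Language {
  fsym : Type;
  rsym : Type;
  farity : fsym -> nat;
  rarity : rsym -> nat }.

(* The universe is a subset of an ambient type [U], so that the universes of
   two structures over the same [U] may share elements. *)
Record structure (L : language) (U : Type) := Structure {
  univ :> set U;
  finterp : forall f : fsym L, {ffun 'I_(farity f) -> univ} -> univ;
  rinterp : forall r : rsym L, {ffun 'I_(rarity r) -> univ} -> Prop }.

Section Syntax.
Variable L : language.

(* Variables are natural numbers. *)
Inductive term : Type :=
| Var of nat
| App (f : fsym L) of {ffun 'I_(farity f) -> term}.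

(* Implication and equivalence are abbreviations and not primitive: as
   primitives they would allow disjunctions to be expressed covertly. *)
Inductive formula : Type :=
| Eq of term & term
| Rel (r : rsym L) of {ffun 'I_(rarity r) -> term}
| Not of formula
| And of formula & formula
| Or of formula & formula
| Ex of nat & formula
| All of nat & formula.

Fixpoint term_vars (t : term) : set nat :=
  match t with
  | Var x => [set x]
  | App f ts => [set x | exists i, term_vars (ts i) x]
  end.

Fixpoint free_vars (phi : formula) : set nat :=
  match phi with
  | Eq s t => term_vars s `|` term_vars t
  | Rel r ts => [set x | exists i, term_vars (ts i) x]
  | Not p => free_vars p
  | And p q | Or p q => free_vars p `|` free_vars q
  | Ex x p | All x p => free_vars p `\` [set x]
  end.

Definition atomic (phi : formula) : bool :=
  match phi with
  | Eq _ _ | Rel _ _ => true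
  | _ => false
  end.

Fixpoint conjunctive (phi : formula) : bool :=
  match phi with
  | Eq _ _ | Rel _ _ => true
  | Not p => atomic p
  | And p q => conjunctive p && conjunctive q
  | Or _ _ => false
  | Ex _ p | All _ p => conjunctive p
  end.

End Syntax.

Section Semantics.
Variables (L : language) (U : Type) (A : structure L U).

Fixpoint eval (v : nat -> A) (t : term L) : A :=
  match t with
  | Var x => v x
  | App f ts => finterp [ffun i => eval v (ts i)]
  end.

Definition update (v : nat -> A) (x : nat) (a : A) : nat -> A :=
  fun z => if z == x then a else v z.

Fixpoint sat (v : nat -> A) (phi : formula L) : Prop :=
  match phi with
  | Eq s t => eval v s = eval v t
  | Rel r ts => rinterp [ffun i => eval v (ts i)]
  | Not p => ~ sat v p
  | And p q => sat v p /\ sat v q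
  | Or p q => sat v p \/ sat v q
  | Ex x p => exists a : A, sat (update v x a) p
  | All x p => forall a : A, sat (update v x a) p
  end.

(* The distinguished variable y of the formulas phi(y) *)
Definition yvar : nat := 0.

(* When y is the only free variable of [phi], only the value of the assignment
   at y matters, so the constant assignment expresses A |= phi(a). *)
Definition ctype (a : A) : set (formula L) :=
  [set phi | [/\ conjunctive phi, free_vars phi = [set yvar]
               & sat (fun=> a) phi]].

End Semantics.

Section Similarity.
Variables (L : language) (U : Type).
Implicit Types A B : structure L U.

Definition common_ctype A B (a : A) (b : B) : set (formula L) :=
  ctype a `&` ctype b.

(* [b'] and [a] have different types; "b' <> a" is inequality in [U]. *)
Definition lesssim A B (a : A) (b : B) : Prop :=
  ~ exists b' : B,
      val b' <> val a /\ common_ctype a b `<` common_ctype a b'.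

Definition approx A B (a : A) (b : B) : Prop :=
  lesssim a b /\ lesssim b a.

Definition isomorphism A B (F : A -> B) : Prop :=
  [/\ bijective F,
      forall (f : fsym L) (t : {ffun 'I_(farity f) -> A}),
        F (finterp t) = finterp [ffun i => F (t i)]
    & forall (r : rsym L) (t : {ffun 'I_(rarity r) -> A}),
        rinterp t <-> rinterp [ffun i => F (t i)]].

End Similarity.

(* Main.v *)
Require Import Defs.
From mathcomp Require Import all_boot.
From mathcomp Require Import boolp classical_sets.

(** An isomorphism preserves satisfaction, so [a] and [F a] have the same
    conjunctive type, and [T(a, F a)] is all of it.  Every other [T(a, b')] is
    contained in the type of [a], hence cannot be strictly larger. *)

Lemma eval_isomorphism (L : language) (U : Type) (A B : structure L U)
    (F : A -> B) (hF : isomorphism F) (v : nat -> A) (w : nat -> B) :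
  (forall x, w x = F (v x)) ->
  forall t : term L, eval w t = F (eval v t).
Proof.
(* The recursion is set up by hand, since the subterms of [App] are nested inside a finite
   function. *)
case: hF => _ hf _ wE; fix IH 1 => -[x|f ts] /=; first exact: wE.
rewrite hf; congr (finterp _); apply/ffunP => i.
by rewrite !ffunE; apply: IH.
Qed.

(** Induction on [phi]: an equivalence is carried along because negation swaps its directions, and
    [v], [w] stay general because quantifiers update them. *)
Lemma sat_isomorphism (L : language) (U : Type) (A B : structure L U)
    (F : A -> B) (hF : isomorphism F) (phi : formula L) :
  forall (v : nat -> A) (w : nat -> B), (forall x, w x = F (v x)) ->
  sat v phi <-> sat w phi.
Proof.
have [[G FK GK] _ hr] := hF.
have updE v w x a : (forall z, w z = F (v z)) ->
    forall z, update w x (F a) z = F (update v x a z).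
  by move=> wE z; rewrite /update; case: ifP.
elim: phi => [s t|r ts|p IH|p IHp q IHq|p IHp q IHq|x p IH|x p IH] v w wE /=.
- rewrite !(eval_isomorphism _ _ _ _ _ hF _ _ wE); split=> [->//|].
  (* Injectivity of [F] reflects equations back to [A]. *)
  exact: can_inj FK _ _.
- rewrite hr; suff -> : [ffun i => F ([ffun j => eval v (ts j)] i)]
      = [ffun i => eval w (ts i)] by [].
  by apply/ffunP => i; rewrite !ffunE (eval_isomorphism _ _ _ _ _ hF _ _ wE).
- by rewrite (IH _ _ wE).
- by rewrite (IHp _ _ wE) (IHq _ _ wE).
- by rewrite (IHp _ _ wE) (IHq _ _ wE).
- split=> [[a ha]|[b hb]].
    by exists (F a); apply/(IH _ _ (updE _ _ x a wE)).
  (* Surjectivity: every [b] is [F (G b)], so [G b] is the matching value in [A]; the universal case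
     uses the same preimage. *)
  by exists (G b); apply/(IH _ _ (updE _ _ x (G b) wE)); rewrite GK.
- split=> [h b|h a]; last by apply/(IH _ _ (updE _ _ x a wE)).
  by rewrite -(GK b); apply/(IH _ _ (updE _ _ x (G b) wE)).
Qed.

Lemma ctype_isomorphism (L : language) (U : Type) (A B : structure L U)
    (F : A -> B) (hF : isomorphism F) (a : A) : ctype (F a) = ctype a.
Proof.
rewrite /ctype; apply/seteqP; split=> phi /= [cphi fphi hphi]; split=> //;
  by apply/(sat_isomorphism _ _ _ _ _ hF phi (fun=> a) (fun=> F a)).
Qed.

(** Equality of types is symmetric, so this one criterion serves both halves of [approx] without
    passing to the inverse isomorphism. *)
Lemma eq_ctype_lesssim (L : language) (U : Type) (A B : structure L U)
    (a : A) (b : B) : ctype b = ctype a -> lesssim a b.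
Proof.
by move=> ab [b' [_ [_]]]; apply; rewrite /common_ctype ab setIid; apply: subIsetl.
Qed.

Theorem mainTheorem2 (L : language) (U : Type) (A B : structure L U)
    (F : A -> B) (hF : isomorphism F) (a : A) :
  approx a (F a).
Proof.
by split; apply: eq_ctype_lesssim; rewrite (ctype_isomorphism _ _ _ _ _ hF).
Qed.
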